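(* Let $E$ be an order continuous Banach lattice with a weak unit, represented as a Köthe function space over a probability space $(\Omega,\Sigma,\mu)$ as described in the context, let $Y$ be a Banach space and $T\in \mathrm{L}(E,Y)$. The following are equivalent: (1) $T$ is disjointly non-singular. (2) There exists $r>0$ such that for every sequence $(x_n)$ in $S_E$ with $\lim_{n\to\infty}\mu(\operatorname{supp} x_n)=0$ we have $\liminf_{n\to\infty}\|Tx_n\|>r$. (3) For every sequence $(x_n)$ in $S_E$ with $\lim_{n\to\infty}\mu(\operatorname{supp} x_n)=0$ we have $\liminf_{n\to\infty}\|Tx_n\|>0$. (4) There is $r>0$ such that for every $x\in S_E$ with $\mu(\operatorname{supp} x)<r$ we have $\|Tx\|>r$.
   Context: Operators are bounded linear maps; $\mathrm{L}(E,Y)$ denotes the operators from $E$ to $Y$, and $S_E$ is the unit sphere of $E$. A Banach lattice $E$ is order continuous if every net decreasing in order to $0$ converges in norm to $0$; $e\in E_+$ is a weak unit if $|x|\wedge e=0$ implies $x=0$. Representation: every order continuous Banach lattice $E$ with a weak unit can be represented over a probability space $(\Omega,\Sigma,\mu)$ so that $L_\infty(\mu)\subset E\subset L_1(\mu)$, $E$ is dense in $L_1(\mu)$, $L_\infty(\mu)$ is dense in $E$, $\|f\|_1\le\|f\|_E\le 2\|f\|_\infty$ for $f\in L_\infty(\mu)$, and the order of $E$ is the one induced by $L_1(\mu)$; such a representation is fixed. For $x\in E$, $\operatorname{supp}x=\{t\in\Omega: x(t)\neq 0\}$. For a sequence $(x_n)$, $[x_n]$ is its closed linear span. An operator is strictly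 singular if it is an isomorphism on no closed infinite-dimensional subspace. An operator $T\in\mathrm{L}(E,Y)$ is disjointly non-singular ($T\in\mathrm{DN\text{-}S}(E,Y)$) if there is no disjoint sequence $(x_n)$ of non-zero vectors of $E$ such that the restriction of $T$ to $[x_n]$ is strictly singular. *)

(* Defs.v *)
From HB Require Import structures.
From mathcomp Require Import all_boot all_order all_algebra.
From mathcomp Require Import all_classical all_reals all_analysis.
Set Implicit Arguments. Unset Strict Implicit. Unset Printing Implicit Defensive.
Import Order.TTheory GRing.Theory Num.Theory.
Import numFieldNormedType.Exports.
Local Open Scope classical_set_scope.
Local Open Scope ring_scope.

Section Defs.
Context {R : realType} {d : measure_display} {Om : measurableType d}.
Variable (mu : probability Om R).
Context {V : normedModType R}.
(* j x is a (fixed) representative in L_0(mu) of the element x of E. *)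
Variable (j : V -> Om -> R).

Definition supp (x : V) : set Om := [set t | j x t != 0].

Definition Ele (x y : V) : Prop := {ae mu, forall t, j x t <= j y t}.

Definition ess_bdd_by (f : Om -> R) (M : R) : Prop := {ae mu, forall t, `|f t| <= M}.

(* lattice disjointness |x| /\ |y| = 0, lattice operations being pointwise a.e. *)
Definition ldisjoint (x y : V) : Prop :=
  {ae mu, forall t, Num.min `|j x t| `|j y t| = 0}.

Definition order_continuous : Prop :=
  forall (I : Type) (le : I -> I -> Prop) (x : I -> V),
    inhabited I ->
    (forall i, le i i) ->
    (forall i k l, le i k -> le k l -> le i l) ->
    (forall i k, exists l, le i l /\ le k l) ->
    (forall i k, le i k -> Ele (x k) (x i)) ->
    (forall i, Ele 0 (x i)) ->
    (forall z, (forall i, Ele z (x i)) -> Ele z 0) ->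
    forall e : R, 0 < e -> exists i0, forall i, le i0 i -> `|x i| < e.

Definition weak_unit (e : V) : Prop :=
  Ele 0 e /\
  forall x, {ae mu, forall t, Num.min `|j x t| (j e t) = 0} -> x = 0.

(* E (with its norm) is an order continuous Banach lattice with a weak unit,
   represented as a Koethe function space over the probability space
   (Om, mu) via x |-> j x, as described in the context. *)
Record kothe_repr : Prop := {
  kr_meas : forall x, measurable_fun setT (j x);
  kr_lin : forall (a : R) (x y : V),
      {ae mu, forall t, j (a *: x + y) t = a * j x t + j y t};
  kr_inj : forall x, {ae mu, forall t, j x t = 0} -> x = 0;
  (* E is a sublattice: |x| belongs to E *)
  kr_abs : forall x, exists y, {ae mu, forall t, j y t = `|j x t|};
  kr_riesz : forall x y, {ae mu, forall t, `|j x t| <= `|j y t|} -> `|x| <= `|y|;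
  kr_L1 : forall x, mu.-integrable setT (fun t => (j x t)%:E);
  kr_Linf : forall (f : Om -> R) (M : R), measurable_fun setT f ->
      ess_bdd_by f M -> exists x, {ae mu, forall t, j x t = f t};
  kr_norm1 : forall x M, ess_bdd_by (j x) M ->
      (\int[mu]_t (`|j x t|)%:E <= (`|x|)%:E)%E;
  kr_normInf : forall x M, ess_bdd_by (j x) M -> `|x| <= 2 * M;
  kr_dense1 : forall f : Om -> R, mu.-integrable setT (fun t => (f t)%:E) ->
      forall e : R, 0 < e ->
      exists x, (\int[mu]_t (`|f t - j x t|)%:E < e%:E)%E;
  kr_denseInf : forall x (e : R), 0 < e ->
      exists y M, ess_bdd_by (j y) M /\ `|x - y| < e;
  kr_oc : order_continuous;
  kr_wu : exists e, weak_unit e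
}.

End Defs.

Section Ops.
Context {R : realType} {V Y : normedModType R}.

Definition bounded_op (T : V -> Y) : Prop :=
  exists M : R, forall x, `|T x| <= M * `|x|.

Definition span_seq (s : nat -> V) : set V :=
  [set v | exists (n : nat) (a : nat -> R), v = \sum_(i < n) a i *: s i].

Definition closed_span (s : nat -> V) : set V := closure (span_seq s).

Definition lsubspace (Z : set V) : Prop :=
  Z 0 /\ (forall x y, Z x -> Z y -> Z (x + y)) /\
  (forall (a : R) x, Z x -> Z (a *: x)).

Definition infinite_dim (Z : set V) : Prop :=
  forall n : nat, exists v : 'I_n -> V, (forall i, Z (v i)) /\
    forall a : 'I_n -> R, \sum_(i < n) a i *: v i = 0 -> forall i, a i = 0.

Definition isomorphism_on (T : V -> Y) (Z : set V) : Prop :=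
  exists c : R, 0 < c /\ forall z, Z z -> c * `|z| <= `|T z|.

Definition strictly_singular_on (T : V -> Y) (W : set V) : Prop :=
  forall Z : set V, Z `<=` W -> lsubspace Z -> closed Z -> infinite_dim Z ->
    ~ isomorphism_on T Z.
End Ops.

Definition DNS {R : realType} {d : measure_display} {Om : measurableType d}
  (mu : probability Om R) {V Y : normedModType R} (j : V -> Om -> R)
  (T : V -> Y) : Prop :=
  ~ exists x : nat -> V, (forall n, x n != 0) /\
      (forall n m, n != m -> ldisjoint mu j (x n) (x m)) /\
      strictly_singular_on T (closed_span x).

(* Main.v *)
(** (1) => (4): if (4) fails, there are normalised vectors with arbitrarily small
    supports and arbitrarily small images. By density they may be taken bounded,
    and order continuity makes the norm of a bounded vector absolutely continuous
    with respect to [mu]; a sliding hump then yields a disjoint sequence [y_i]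
    with [|y_i| >= 1/2] and [|T y_i| <= C / 2^i]. Disjoint sequences are
    unconditional basic, and every infinite-dimensional subspace of [[y_i]]
    contains nonzero vectors whose first [N] coordinates vanish, on which [T] is
    small; hence [T] is strictly singular on [[y_i]].

    (4) => (1): for a disjoint sequence [x_i], the measure of the union of the
    supports of [x_i], [i >= N], tends to [0], so (4) makes [T] an isomorphism on
    the closed span of a tail. *)

Require Import Defs.
From HB Require Import structures.
From mathcomp Require Import all_boot all_order all_algebra.
From mathcomp Require Import all_classical all_reals all_analysis.
From mathcomp Require Import measurable_realfun ess_sup_inf lra.
Set Implicit Arguments.
Unset Strict Implicit.
Unset Printing Implicit Defensive.
Import Order.TTheory GRing.Theory Num.Theory.
Import numFieldNormedType.Exports.
Local Open Scope classical_set_scope.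
Local Open Scope ring_scope.

(** * Linear spans and their closures *)

Section Spans.
Context {R : realType} {V : normedModType R}.
Implicit Types (A : set V) (s : nat -> V) (b : nat -> R) (z : V).

Lemma closure_approx A z (e : R) : closure A z -> 0 < e ->
  exists2 v, A v & `|z - v| < e.
Proof.
move=> + e0 => /(_ _ (nbhsx_ballx z e e0))[v [Av]].
by rewrite -ball_normE /= => zv; exists v.
Qed.

Lemma closure_approxP A z :
  (forall e : R, 0 < e -> exists2 v, A v & `|z - v| < e) -> closure A z.
Proof.
move=> H B /nbhs_ballP[e /= e0 zeB]; have [v Av zv] := H _ e0.
by exists v; split => //; apply: zeB; rewrite -ball_normE.
Qed.

Lemma sum_finsupp_widen s b n m : (forall i, (n <= i)%N -> b i = 0) ->
  (n <= m)%N -> \sum_(i < m) b i *: s i = \sum_(i < n) b i *: s i.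
Proof.
move=> b0 nm; rewrite (big_ord_widen m (fun i => b i *: s i) nm).
rewrite [RHS]big_mkcond; apply: eq_bigr => i _.
by case: ifPn => //; rewrite -leqNgt => /b0 ->; rewrite scale0r.
Qed.

(** Zeroing the coefficients from [n] on lets combinations of different lengths be extended to a
    common length and added. *)
Lemma span_seq_finsupp s v : span_seq s v -> exists n b,
  (forall i, (n <= i)%N -> b i = 0) /\ v = \sum_(i < n) b i *: s i.
Proof.
move=> [n [a ->]]; exists n, (fun i => if (i < n)%N then a i else 0).
split=> [i|]; first by rewrite ltnNge => ->.
by apply: eq_bigr => i _; rewrite ltn_ord.
Qed.

Lemma span_seq_lsubspace s : lsubspace (span_seq s).
Proof.
split; first by exists 0%N, (fun=> 0); rewrite big_ord0.
split=> [x y /span_seq_finsupp[n [b [b0 ->]]] /span_seq_finsupp[m [c [c0 ->]]]|a x].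
  exists (maxn n m), (fun i => b i + c i).
  rewrite -(sum_finsupp_widen _ b0 (leq_maxl n m)).
  rewrite -(sum_finsupp_widen _ c0 (leq_maxr n m)) -big_split.
  by apply: eq_bigr => i _; rewrite scalerDl.
move=> [n [b ->]]; exists n, (fun i => a * b i).
by rewrite scaler_sumr; apply: eq_bigr => i _; rewrite scalerA.
Qed.

Lemma closure_lsubspace A : lsubspace A -> lsubspace (closure A).
Proof.
move=> [A0 [AD AZ]]; split; first exact: subset_closure.
split=> [x y clx cly|a x clx]; apply: closure_approxP => e e0.
  have e20 : 0 < e / 2 by lra.
  have [v Av xv] := closure_approx clx e20.
  have [w Aw yw] := closure_approx cly e20.
  exists (v + w); first exact: AD.
  rewrite opprD addrACA; apply: le_lt_trans (ler_normD _ _) _; lra.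
have a1 : 0 < `|a| + 1 by rewrite ltr_wpDl.
have [|v Av xv] := @closure_approx _ _ (e / (`|a| + 1)) clx.
  exact: divr_gt0.
exists (a *: v); first exact: AZ.
rewrite -scalerBr normrZ.
move: xv; rewrite ltr_pdivlMr// => xv; apply: le_lt_trans xv.
by rewrite mulrC ler_wpM2l// lerDl.
Qed.

Lemma lsubspace_sum (Z : set V) n (a : 'I_n -> R) (v : 'I_n -> V) :
  lsubspace Z -> (forall i, Z (v i)) -> Z (\sum_(i < n) a i *: v i).
Proof.
by move=> [Z0 [ZD ZZ]] Zv; elim/big_ind: _ => // i _; exact: ZZ.
Qed.

End Spans.

(** * Left kernels, geometric tails and operator bounds *)

Lemma exists_left_kernel (F : fieldType) N (M : 'M[F]_(N.+1, N)) :
  exists2 l : 'rV_N.+1, l != 0 & l *m M = 0.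
Proof.
have : kermx M != 0.
  rewrite -mxrank_eq0 mxrank_ker subn_eq0 -ltnNge ltnS.
  exact: rank_leq_col.
by move=> /rowV0Pn[l /sub_kermxP lM l0]; exists l.
Qed.

Lemma geometric_tail_le (R : realFieldType) N n :
  \sum_(i < n | (N <= i)%N) (2^-1 : R) ^+ i <= 2 * 2^-1 ^+ N.
Proof.
have h0 k : 0 < (2^-1 : R) ^+ k by rewrite exprn_gt0 ?invr_gt0.
(* Adding the exact remainder makes the bound inductive: each new term halves it. *)
suff : \sum_(i < n | (N <= i)%N) (2^-1 : R) ^+ i + 2 * 2^-1 ^+ (maxn N n)
    <= 2 * 2^-1 ^+ N.
  by apply: le_trans; rewrite lerDl mulr_ge0 ?ltW.
elim: n => [|n IH]; first by rewrite big_ord0 maxn0 add0r.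
rewrite big_mkcond big_ord_recr -big_mkcond /=.
case: leqP => Nn.
  move: IH; rewrite (maxn_idPr Nn) (maxn_idPr (leqW Nn)) exprS.
  lra.
by move: IH; rewrite (maxn_idPl (ltnW Nn)) (maxn_idPl Nn) addr0.
Qed.

Lemma exists_half_pow_lt (R : realType) (e : R) : 0 < e ->
  exists n, (2^-1 : R) ^+ n < e.
Proof.
move=> e0; have h1 : `|2^-1 : R| < 1 by rewrite gtr0_norm; lra.
have /cvgrPdist_lt /(_ _ e0)[n _ /(_ n (leqnn n))] := cvg_expr h1.
rewrite /= sub0r normrN gtr0_norm ?exprn_gt0 ?invr_gt0// => ne.
by exists n.
Qed.

(** The constant in [bounded_op] may be negative when the domain is trivial. *)
Lemma bounded_op_ge0 (R : realType) (V W : normedModType R) (T : V -> W) :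
  bounded_op T -> exists2 M : R, 0 <= M & forall x, `|T x| <= M * `|x|.
Proof.
move=> [M TM]; exists (Num.max M 0); first by rewrite le_max lexx orbT.
by move=> x; apply: le_trans (TM x) _; rewrite ler_wpM2r// le_max lexx.
Qed.

(** * Unconditional sequences and strict singularity *)

Section Unconditional.
Context {R : realType} {V : normedModType R}.
Implicit Types (y : nat -> V).

(** Unconditionality with suppression constant 1, phrased on finite combinations so that no series
    has to converge. *)
Definition suppression_unconditional y := forall n (b : nat -> R) (P : pred nat),
  `|\sum_(i < n | P i) b i *: y i| <= `|\sum_(i < n) b i *: y i|.

Lemma unconditional_coef y n (b : nat -> R) i : suppression_unconditional y -> (i < n)%N ->
  `|b i| * `|y i| <= `|\sum_(k < n) b k *: y k|.
Proof.
move=> uy lin; have := uy n b (pred1 i).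
by rewrite (big_pred1 (Ordinal lin)) ?normrZ.
Qed.

Variable y : nat -> V.
Hypothesis uy : suppression_unconditional y.
Hypothesis y_ge : forall i, 2^-1 <= `|y i|.

Let coef_le n (b : nat -> R) i : (i < n)%N -> `|b i| <= 2 * `|\sum_(k < n) b k *: y k|.
Proof.
move=> lin; have := unconditional_coef b uy lin.
have : `|b i| * 2^-1 <= `|b i| * `|y i| by rewrite ler_wpM2l.
lra.
Qed.

(** The coefficients vanish from [n] on, so that two approximations can be compared over one common
    range. *)
Let is_approx z n (b : nat -> R) (e : R) := (forall i, (n <= i)%N -> b i = 0) /\
  `|z - \sum_(i < n) b i *: y i| < e.

Let approx_coef z n b e m c f i : is_approx z n b e -> is_approx z m c f ->
  `|b i - c i| <= 2 * (e + f).
Proof.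
move=> [b0 zb] [c0 zc]; pose k := maxn i.+1 (maxn n m).
have nk : (n <= k)%N by rewrite !leq_max leqnn !orbT.
have mk : (m <= k)%N by rewrite !leq_max leqnn !orbT.
have ik : (i < k)%N by rewrite leq_max leqnn.
apply: le_trans (coef_le (fun j => b j - c j) ik) _.
rewrite ler_wpM2l//; under eq_bigr do rewrite scalerBl.
rewrite sumrB (sum_finsupp_widen _ b0 nk) (sum_finsupp_widen _ c0 mk).
rewrite -(subrKA z); apply: le_trans (ler_normD _ _) _.
by rewrite (distrC _ z) lerD// ltW.
Qed.

(* The coordinates of [z] are obtained as suprema, since the coordinates of any
   two approximations of [z] are close to each other. *)
Lemma closed_span_coordinates z : closed_span y z ->
  exists a : nat -> R, forall n b e, (forall i, (n <= i)%N -> b i = 0) ->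
    `|z - \sum_(i < n) b i *: y i| < e -> forall i, `|b i - a i| <= 2 * e.
Proof.
move=> yz.
pose S i := [set x | exists n b e, is_approx z n b e /\ x = b i - 2 * e].
have ub i m c f : is_approx z m c f -> ubound (S i) (c i + 2 * f).
  move=> zc _ [n [b [e [zb ->]]]].
  by have := approx_coef i zb zc; rewrite ler_norml => /andP[_]; lra.
exists (fun i => sup (S i)) => n b e b0 zb i.
have Sb : S i (b i - 2 * e) by exists n, b, e.
have hS : has_sup (S i).
  by split; [exists (b i - 2 * e)|exists (b i + 2 * e); apply: (ub i n)].
have := sup_upper_bound hS Sb.
have : sup (S i) <= b i + 2 * e by apply: ge_sup; [case: hS|apply: (ub i n)].
by rewrite ler_norml => *; apply/andP; split; lra.
Qed.

(** Dimension count: among [N.+1] independent vectors of [Z], some nontrivial combination has its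
    first [N] coordinates zero. Its approximations have small, not zero, first coefficients, and
    dropping these costs little. *)
Lemma subspace_meets_tail (Z : set V) N : Z `<=` closed_span y -> lsubspace Z ->
  infinite_dim Z -> exists z, [/\ Z z, z != 0 & forall e : R, 0 < e ->
    exists n (b : nat -> R), `|z - \sum_(i < n | (N <= i)%N) b i *: y i| < e].
Proof.
move=> Zy sZ /(_ N.+1)[v [Zv vfree]].
have /choice[a ha] k := closed_span_coordinates (Zy _ (Zv k)).
have [l l0 la] := exists_left_kernel (\matrix_(k < N.+1, i < N) a k i).
exists (\sum_(k < N.+1) l 0 k *: v k); split; first exact: lsubspace_sum.
  apply: contra_neq l0 => /vfree l0; apply/rowP => k; rewrite l0 mxE//.
move=> e e0.
pose L := \sum_(k < N.+1) `|l 0 k|.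
have L0 : 0 <= L by apply: sumr_ge0.
pose S := \sum_(i < N) `|y i|.
have S0 : 0 <= S by apply: sumr_ge0.
(* [L] pays for approximating the [v k], and [2 * L * S] for deleting the first [N] terms. Dividing
   by [K + 1] below also covers [K = 0]. *)
pose K := L + 2 * L * S.
have K0 : 0 <= K by rewrite addr_ge0// !mulr_ge0.
pose f := e / (K + 1).
have f0 : 0 < f by rewrite divr_gt0// ltr_wpDl.
have Kfe : K * f < e.
  by rewrite mulrCA gtr_pMr// ltr_pdivrMr ?ltr_wpDl// mul1r ltrDl.
have /choice[n /choice[b nb]] k : exists n b, is_approx (v k) n b f.
  have [w /span_seq_finsupp[n [b [b0 ->]]] vb] := closure_approx (Zy _ (Zv k)) f0.
  by exists n, b.
pose m := maxn N (\max_k n k).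
have nm k : (n k <= m)%N by rewrite leq_max (leq_bigmax k) orbT.
pose B i := \sum_(k < N.+1) l 0 k * b k i.
have sB : \sum_(i < m) B i *: y i = \sum_k l 0 k *: \sum_(i < n k) b k i *: y i.
  under eq_bigr do rewrite scaler_suml.
  rewrite exchange_big; apply: eq_bigr => k _.
  rewrite -(sum_finsupp_widen _ (nb k).1 (nm k)) scaler_sumr.
  by apply: eq_bigr => i _; rewrite scalerA.
(* The kernel relation allows subtracting the exact coordinates [a k i] from the [b k i] for
   free. *)
have Bsmall i : (i < N)%N -> `|B i| <= 2 * L * f.
  move=> iN; have : \sum_k l 0 k * a k i = 0.
    move/matrixP: la => /(_ 0 (Ordinal iN)); rewrite !mxE => {2}<-.
    by apply: eq_bigr => k _; rewrite mxE.
  move=> la0; rewrite -[B i]subr0 -la0 -sumrB.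
  apply: le_trans (ler_norm_sum _ _ _) _.
  rewrite -mulrA mulrCA mulr_suml; apply: ler_sum => k _.
  rewrite -mulrBr normrM ler_wpM2l//; apply: ha (nb k).1 (nb k).2 i.
exists m, B; apply: le_lt_trans Kfe.
have -> : \sum_(i < m | (N <= i)%N) B i *: y i =
    \sum_(i < m) B i *: y i - \sum_(i < N) B i *: y i.
  rewrite (big_ord_widen m (fun i => B i *: y i) (leq_maxl _ _)).
  apply/eqP; rewrite eq_sym subr_eq (bigID (fun i : 'I_m => (N <= i)%N))/=.
  by apply/eqP; congr (_ + _); apply: eq_bigl => i; rewrite ltnNge.
rewrite opprB addrCA addrC.
apply: le_trans (ler_normD _ _) _; rewrite mulrDl lerD//.
  rewrite sB -sumrB; apply: le_trans (ler_norm_sum _ _ _) _.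
  rewrite mulr_suml; apply: ler_sum => k _.
  by rewrite -scalerBr normrZ ler_wpM2l// ltW// (nb k).2.
apply: le_trans (ler_norm_sum _ _ _) _.
rewrite mulrAC mulr_sumr; apply: ler_sum => i _.
by rewrite normrZ ler_wpM2r// Bsmall.
Qed.

(** On combinations starting at [N], coefficients are at most twice the norm, so the norm of [T]
    there is at most [4 * C * 2^-1 ^+ N]. A lower bound [c] on [Z] fails at a vector of [Z] close to
    such combinations. *)
Lemma summable_images_strictly_singular {W : normedModType R} (T : {linear V -> W})
    (C : R) : bounded_op T -> (forall i, `|T (y i)| <= C * 2^-1 ^+ i) ->
  strictly_singular_on T (closed_span y).
Proof.
move=> /bounded_op_ge0[M M_ge0 TM] TC Z Zy sZ clZ iZ [c [c0 cT]].
have C0 : 0 <= C by have := TC 0%N; rewrite expr0 mulr1; apply: le_trans.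
(* In [4 * C], one factor 2 comes from the coefficient bound, the other from the geometric tail. *)
have [N etac] : exists N, 4 * C * (2^-1 : R) ^+ N < c.
  have K0 : 0 < 4 * C + 1 by lra.
  have d0 : 0 < c / (4 * C + 1) by rewrite divr_gt0.
  have [N h] := exists_half_pow_lt d0; exists N.
  move: h; rewrite ltr_pdivlMr// mulrDr mulr1 mulrC => /(le_lt_trans _); apply.
  by rewrite lerDl exprn_ge0// invr_ge0.
have [z [Zz z0 zapp]] := @subspace_meets_tail Z N Zy sZ iZ.
set eta := 4 * C * _ in etac.
have eta0 : 0 <= eta by rewrite !mulr_ge0// exprn_ge0// invr_ge0.
have Tail n (b : nat -> R) : `|T (\sum_(i < n | (N <= i)%N) b i *: y i)| <=
    eta * `|\sum_(i < n | (N <= i)%N) b i *: y i|.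
  pose b' i := if (N <= i)%N then b i else 0.
  have E : \sum_(i < n | (N <= i)%N) b i *: y i = \sum_(i < n) b' i *: y i.
    rewrite big_mkcond; apply: eq_bigr => i _.
    by rewrite /b'; case: ifP; rewrite ?scale0r.
  set s := \sum_(i < n | _) _.
  rewrite {1}/s linear_sum.
  apply: le_trans (ler_norm_sum _ _ _) _.
  have : \sum_(i < n | (N <= i)%N) `|T (b i *: y i)| <=
     \sum_(i < n | (N <= i)%N) (2 * `|s| * C) * 2^-1 ^+ i.
    apply: ler_sum => i Ni; rewrite linearZ normrZ -mulrA.
    apply: ler_pM => //.
    by have := coef_le b' (ltn_ord i); rewrite -E /b' Ni.
  move=> /le_trans; apply; rewrite -mulr_sumr.
  have := @geometric_tail_le R N n.
  have sC : 0 <= 2 * `|s| * C by rewrite !mulr_ge0.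
  move=> /(ler_wpM2l sC) /le_trans; apply.
  by rewrite /eta; lra.
have nz0 : 0 < `|z| by rewrite normr_gt0.
(* With this [e], [(eta + M) * e] is strictly below [(c - eta) * |z|], which contradicts the lower
   bound [c] at [z]. *)
pose D := eta + M + 1.
have D0 : 0 < D by rewrite /D; lra.
pose e := (c - eta) * `|z| / D.
have e0 : 0 < e by rewrite divr_gt0// mulr_gt0// subr_gt0.
have [n [b zb]] := zapp e e0.
set s := \sum_(i < n | _) _ in zb.
have h1 : `|T z| <= `|T s| + M * e.
  rewrite -[z](subrK s) linearD; apply: le_trans (ler_normD _ _) _.
  by rewrite addrC lerD2l; apply: le_trans (TM _) _; rewrite ler_wpM2l// ltW.
have h2 : `|s| <= `|z| + e.
  rewrite -[s](subrK z); apply: le_trans (ler_normD _ _) _.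
  by rewrite addrC lerD2l distrC ltW.
have h3 := Tail n b; rewrite -/s in h3.
have h4 : eta * `|s| <= eta * (`|z| + e) by rewrite ler_wpM2l.
have h5 := cT z Zz.
have h6 : e * D = (c - eta) * `|z| by rewrite /e divfK// gt_eqF.
rewrite /D in h6; lra.
Qed.

End Unconditional.

(** * Almost everywhere inclusions and unions of small sets *)

Section Measure.
Context {R : realType} {d : measure_display} {Om : measurableType d}.
Variable mu : probability Om R.

Lemma ae_le_measure (A B : set Om) : measurable A -> measurable B ->
  {ae mu, forall t, A t -> B t} -> (mu A <= mu B)%E.
Proof.
move=> mA mB [N [mN N0 AB]].
have sub : A `<=` B `|` N.
  move=> t At; have [Bt|nBt] := pselect (B t); [by left|right].
  by apply: AB => /= /(_ At).
rewrite (@le_trans _ _ (mu (B `|` N)))//.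
  by apply: le_measure; rewrite ?inE//; exact: measurableU.
apply: le_trans (measureU2 _ mB mN) _.
by rewrite [X in (_ + X)%E](_ : _ = 0%E) ?adde0.
Qed.

Lemma measure_bigcup_geometric (A : nat -> set Om) (c : R) : 0 <= c ->
  (forall m, measurable (A m)) ->
  (forall m, mu (A m) <= (c / (2 ^ m.+1)%:R)%:E)%E ->
  (mu (\bigcup_m A m) <= c%:E)%E.
Proof.
move=> c0 mA Ac.
have mU : measurable (\bigcup_m A m) by exact: bigcup_measurable.
have := measure_sigma_subadditive mu mA mU (@subset_refl _ _).
move=> /le_trans; apply.
have := epsilon_trick0 xpredT c0; apply: le_trans.
by apply: lee_nneseries => // m _; exact: Ac.
Qed.

(** Continuity from above for a finite measure: the tail unions decrease to a null set. *)
Lemma measure_tails_cvg0 (A : nat -> set Om) : (forall m, measurable (A m)) ->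
  {ae mu, forall t, exists n, ~ (\bigcup_m A (n + m)%N) t} ->
  mu (\bigcup_m A (n + m)%N) @[n --> \oo] --> 0%E.
Proof.
move=> mA Anull; pose B n := \bigcup_m A (n + m)%N.
have mB n : measurable (B n) by exact: bigcup_measurable.
have mI : measurable (\bigcap_n B n) by exact: bigcap_measurable.
have <- : mu (\bigcap_n B n) = 0%E.
  apply: (measure_negligible mI).
  case: Anull => N [mN N0 sN]; exists N; split => //.
  by move=> t Bt; apply: sN => /= -[n]; apply; exact: (Bt n I).
apply: (@nonincreasing_cvg_mu _ _ _ mu B) => //.
  by apply: le_lt_trans (probability_le1 mu (mB 0%N)) (ltry _).
move=> n m nm; apply/subsetPset => t [k _ Ak].
by exists (m - n + k)%N => //; rewrite addnA subnKC.
Qed.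

End Measure.

(** * Norm and supports in the function space *)

Section Kothe.
Context {R : realType} {d : measure_display} {Om : measurableType d}.
Context {mu : probability Om R} {E : normedModType R} {j : E -> Om -> R}.
Hypothesis HE : kothe_repr mu j.

Lemma measurable_supp x : measurable (supp j x).
Proof.
have -> : supp j x = j x @^-1` (~` [set 0]).
  by apply/seteqP; split=> t /=; [move/eqP|move=> h; apply/eqP].
rewrite -[_ @^-1` _]setTI; apply: (kr_meas HE) => //.
exact: measurableC.
Qed.

Lemma ae_repr0 : {ae mu, forall t, j 0 t = 0}.
Proof.
have := kr_lin HE (-1) 0 0; apply: filterS => t.
by rewrite scaler0 addr0 mulN1r addNr.
Qed.

Lemma ae_reprZ a x : {ae mu, forall t, j (a *: x) t = a * j x t}.
Proof.
by apply: filterS2 (kr_lin HE a x 0) ae_repr0 => t; rewrite addr0 => -> ->; rewrite addr0.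
Qed.

Lemma ae_reprB x y : {ae mu, forall t, j (x - y) t = j x t - j y t}.
Proof.
have := kr_lin HE (-1) y x; apply: filterS => t.
by rewrite scaleN1r addrC => ->; rewrite mulN1r addrC.
Qed.

Lemma ae_repr_sum n (P : pred 'I_n) (b : nat -> R) (y : nat -> E) :
  {ae mu, forall t, j (\sum_(i < n | P i) b i *: y i) t =
                    \sum_(i < n | P i) b i * j (y i) t}.
Proof.
elim: (index_enum _) => [|i s IH].
  by apply: filterS ae_repr0 => t; rewrite !big_nil.
case Pi : (P i); last by apply: filterS IH => t; rewrite !big_cons Pi.
apply: filterS2 IH (kr_lin HE (b i) (y i) (\sum_(i <- s | P i) b i *: y i)) => t.
by rewrite !big_cons Pi => <- ->.
Qed.

Lemma repr_indic (A : set Om) : measurable A ->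
  exists u, {ae mu, forall t, j u t = \1_A t}.
Proof.
move=> mA; apply: (kr_Linf HE) (_ : ess_bdd_by mu _ 1).
  exact: measurable_indic.
by apply: aeW => t; rewrite indicE; case: (_ \in _); rewrite ?normr1 ?normr0.
Qed.

(** The product is essentially bounded, hence represented in [E]; this is why vectors are made
    bounded before being cut off. *)
Lemma repr_restrict (A : set Om) x M : measurable A -> ess_bdd_by mu (j x) M ->
  exists u, {ae mu, forall t, j u t = \1_A t * j x t}.
Proof.
move=> mA xM; apply: (kr_Linf HE) (_ : ess_bdd_by mu _ M).
  apply: measurable_funM; first exact: measurable_indic.
  exact: (kr_meas HE).
apply: filterS xM => t xM; rewrite indicE.
case: (_ \in _); rewrite ?mul1r ?mul0r ?normr0//.
exact: le_trans xM.
Qed.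

(** At almost every point at most one [y i] is nonzero, so the partial sum is pointwise dominated by
    the full one and the lattice norm is monotone. *)
Lemma disjoint_unconditional (y : nat -> E) :
  (forall n m, n != m -> ldisjoint mu j (y n) (y m)) ->
  suppression_unconditional y.
Proof.
move=> dy n b P; apply: (kr_riesz HE).
have dy' : {ae mu, forall t, forall p : 'I_n * 'I_n, p.1 != p.2 ->
    j (y p.1) t = 0 \/ j (y p.2) t = 0}.
  apply: filter_forall => p; have [->|p12] := eqVneq p.1 p.2.
    by apply: aeW => t.
  apply: filterS (dy _ _ p12) => t; rewrite /Num.min.
  by case: ifP => _ /eqP; rewrite normr_eq0 => /eqP; [left|right].
have sT := ae_repr_sum (fun _ : 'I_n => true) b y.
have sP := ae_repr_sum (fun i : 'I_n => P i) b y.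
apply: filterS3 dy' sP sT => t dt -> ->.
have [[k yk]|y0] := pselect (exists k : 'I_n, j (y k) t != 0); last first.
  have z (i : 'I_n) : b i * j (y i) t = 0.
    by have [->|yi] := eqVneq (j (y i) t) 0; [rewrite mulr0|case: y0; exists i].
  by rewrite !big1.
have z (i : 'I_n) : i != k -> b i * j (y i) t = 0.
  move=> ik; case: (dt (i, k) ik) => /= [->|/eqP]; first by rewrite mulr0.
  by rewrite (negbTE yk).
rewrite [X in _ <= `|X|](bigD1 k)//= [X in `|_ + X|]big1 => [|i]; last exact: z.
rewrite addr0; have [Pk|Pk] := boolP (P k).
  by rewrite (bigD1 k)//= big1 ?addr0// => i /andP[_]; exact: z.
rewrite big1 ?normr0// => i Pi; apply: z.
by apply: contraNneq Pk => <-.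
Qed.

(** Otherwise there are sets of measure below [1 / 2 ^ n.+1] whose indicators have norm at least
    [e]. Their tail unions decrease to a null set, so the indicators of these unions decrease to 0
    in order, hence in norm by order continuity, yet they dominate the first indicators. *)
Lemma repr_indic_small (e : R) : 0 < e -> exists2 dl : R, 0 < dl &
  forall (A : set Om) u, measurable A -> (mu A < dl%:E)%E ->
    {ae mu, forall t, j u t = \1_A t} -> `|u| < e.
Proof.
move=> e0; apply: contrapT => H.
have bad n : exists Au : set Om * E, [/\ measurable Au.1,
    (mu Au.1 < (1 / (2 ^ n.+1)%:R)%:E)%E,
    {ae mu, forall t, j Au.2 t = \1_Au.1 t} & e <= `|Au.2|].
  apply: contrapT => nbad; apply: H; exists (1 / (2 ^ n.+1)%:R).
    by rewrite divr_gt0// ltr0n expn_gt0.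
  move=> A u mA Asmall uA; rewrite ltNge; apply/negP => eu.
  by apply: nbad; exists (A, u).
have [Au {bad}] := choice bad; pose A n := (Au n).1; pose u n := (Au n).2.
move=> /all_and4[mA Asmall uA eu].
pose B n := \bigcup_m A (n + m)%N.
have mB n : measurable (B n) by apply: bigcup_measurable => k _; exact: mA.
have muB n : (mu (B n) <= (1 / (2 ^ n)%:R)%:E)%E.
  apply: measure_bigcup_geometric => [|m|m]; first by rewrite divr_ge0.
    exact: mA.
  apply: le_trans (ltW (Asmall _)) _.
  by rewrite lee_fin -addnS expnD natrM invfM mulrA.
have /choice[w wB] n := repr_indic (mB n).
have decB i k : (i <= k)%N -> B k `<=` B i.
  move=> ik t [m _ Am]; exists (k - i + m)%N => //.
  by rewrite addnA subnKC.
have Bnull : {ae mu, forall t, exists n, ~ B n t}.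
  exists (\bigcap_n B n); split.
  - exact: bigcap_measurable.
  - apply/eqP; rewrite -measure_le0; apply/lee_addgt0Pr => f f0.
    rewrite add0e.
    have [n nf] := exists_half_pow_lt f0.
    apply: (@le_trans _ _ (mu (B n))).
      apply: le_measure; rewrite ?inE//; first exact: bigcap_measurable.
      by move=> t; exact.
    apply: le_trans (muB n) _.
    by rewrite lee_fin natrX div1r -exprVn ltW.
  - by move=> t nB n _; apply: contrapT => nBt; apply: nB; exists n.
have [|i|i k l ik|i k|i k ik|i|z zw|n0 /(_ n0 (leqnn n0))] :=
    @kr_oc _ _ _ _ _ _ HE nat (fun i k => (i <= k)%N) w _ _ _ _ _ _ _ e e0.
- exact: (inhabits 0%N).
- exact: leqnn.
- exact: leq_trans ik.
- by exists (maxn i k); rewrite leq_maxl leq_maxr.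
- apply: filterS2 (wB i) (wB k) => t -> ->; rewrite !indicE ler_nat.
  case: (boolP (t \in B k)) => //; rewrite inE => /(decB _ _ ik) ?.
  by rewrite mem_set.
- apply: filterS2 (wB i) ae_repr0 => t -> ->; rewrite indicE; exact: ler0n.
(* A lower bound [z] of all the indicators is nonpositive, since almost every point leaves some
   [B n]. *)
- have zB : {ae mu, forall t, forall n, j z t <= \1_(B n) t}.
    by apply/ae_foralln => n; apply: filterS2 (zw n) (wB n) => t + <-.
  apply: filterS3 ae_repr0 Bnull zB => t -> [n nBt] /(_ n).
  by rewrite indicE memNset.
- apply/negP; rewrite -leNgt; apply: le_trans (eu n0) _.
  apply: (kr_riesz HE).
  apply: filterS2 (uA n0) (wB n0) => t; rewrite /u /= => -> ->.
  rewrite !indicE !ger0_norm ?ler0n// ler_nat.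
  case: (boolP (t \in _)) => //; rewrite inE => At.
  by rewrite mem_set//; exists 0%N => //; rewrite addn0.
Qed.

(** The cut-off of [x] to [A] is dominated by a multiple of the indicator of [A]; the multiple
    [|M| + 1] is positive for every [M]. *)
Lemma bounded_absolutely_continuous x M (e : R) : ess_bdd_by mu (j x) M -> 0 < e ->
  exists2 dl : R, 0 < dl &
  forall (A : set Om) u, measurable A -> (mu A < dl%:E)%E ->
    {ae mu, forall t, j u t = \1_A t * j x t} -> `|u| < e.
Proof.
move=> xM e0; have M1 : 0 < `|M| + 1 by rewrite ltr_wpDl.
have [|dl dl0 H] := @repr_indic_small (e / (`|M| + 1)); first exact: divr_gt0.
exists dl => // A u mA Adl uA; have [v vA] := repr_indic mA.
apply: (@le_lt_trans _ _ `|(`|M| + 1) *: v|).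
  apply: (kr_riesz HE).
  apply: filterS3 (filterI uA xM) vA (ae_reprZ (`|M| + 1) v) => t [-> xMt] vt ->.
  rewrite vt mulrC !normrM ler_wpM2r// (le_trans xMt)//.
  by rewrite (gtr0_norm M1) (le_trans (ler_norm M))// lerDl.
by rewrite normrZ (gtr0_norm M1) mulrC -ltr_pdivlMr// (H A).
Qed.

Lemma ae_supp_closure (S : set E) (B : set Om) z : measurable B ->
  (forall s, S s -> {ae mu, forall t, supp j s t -> B t}) -> closure S z ->
  {ae mu, forall t, supp j z t -> B t}.
Proof.
move=> mB SB clz.
(* The part of [z] outside [B], truncated at 1 so as to be represented in [E]. Each [s] in [S]
   vanishes outside [B], so [f] is dominated by [|z - s|] and has norm 0. *)
pose f t := \1_(~` B) t * Num.min `|j z t| 1.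
have [||y yf] := kr_Linf HE (_ : measurable_fun setT f) (_ : ess_bdd_by mu f 1).
- apply: measurable_funM; first by apply: measurable_indic; exact: measurableC.
  apply: measurable_minr => //; apply: measurableT_comp => //.
  exact: (kr_meas HE).
- apply: aeW => t; rewrite /f indicE; case: (_ \in _).
    by rewrite mul1r ger0_norm ?ge_min ?lexx ?orbT// le_min normr_ge0 ler01.
  by rewrite mul0r normr0.
have y0 : y = 0.
  apply/eqP; rewrite -normr_le0; apply/ler_addgt0Pr => e e0; rewrite add0r.
  have [s Ss zs] := closure_approx clz e0.
  apply: le_trans (ltW zs); apply: (kr_riesz HE).
  apply: filterS3 yf (SB s Ss) (ae_reprB z s) => t -> sB ->.
  rewrite /f indicE; case: (boolP (t \in _)); rewrite ?mul0r ?normr0//.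
  rewrite inE /= => nBt; have -> : j s t = 0.
    by apply/eqP/negPn/negP => /sB.
  have m0 : 0 <= Num.min `|j z t| 1 by rewrite le_min normr_ge0 ler01.
  by rewrite subr0 mul1r (ger0_norm m0) ge_min lexx.
move: yf; rewrite y0 => yf.
apply: filterS2 yf ae_repr0 => t -> f0 zt; apply: contrapT => nBt.
move: f0; rewrite /f indicE mem_set// mul1r => /eqP.
by rewrite gt_eqF// lt_min normr_gt0 zt ltr01.
Qed.

(** Almost every point lies in at most one support, say that of [x k], and so leaves the tail union
    from [k.+1] on. *)
Lemma disjoint_tails_cvg (x : nat -> E) :
  (forall n m, n != m -> ldisjoint mu j (x n) (x m)) ->
  mu (\bigcup_m supp j (x (n + m)%N)) @[n --> \oo] --> 0%E.
Proof.
move=> dx; apply: (@measure_tails_cvg0 _ _ _ mu (fun m => supp j (x m))).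
  by move=> m; exact: measurable_supp.
have dx' : {ae mu, forall t, forall n m, n != m -> j (x n) t = 0 \/ j (x m) t = 0}.
  apply/ae_foralln => n; apply/ae_foralln => m.
  have [->|nm] := eqVneq n m; first by apply: aeW => t.
  apply: filterS (dx _ _ nm) => t; rewrite /Num.min.
  by case: ifP => _ /eqP; rewrite normr_eq0 => /eqP; [left|right].
apply: filterS dx' => t dt.
have [[k xk]|nx] := pselect (exists k, supp j (x k) t).
  exists k.+1 => -[m _ xm]; have : k != (k.+1 + m)%N by rewrite ltn_eqF// leq_addr.
  by move=> /dt[] /eqP; [rewrite (negbTE xk)|rewrite (negbTE xm)].
by exists 0%N => -[m _ xm]; apply: nx; exists m.
Qed.

End Kothe.

(** * Limits in the extended reals *)

Section Limits.
Context {R : realType}.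

Lemma cvg0_lt_near (u : nat -> \bar R) (r : R) : u @ \oo --> 0%E -> 0 < r ->
  \forall n \near \oo, (u n < r%:E)%E.
Proof.
move=> u0 r0; apply: (u0 [set x | (x < r%:E)%E]).
exact: (@nbhs_open_ereal_lt _ 0 (fun=> r)).
Qed.

Lemma limn_einf_ge (u : nat -> \bar R) (r : \bar R) :
  (\forall n \near \oo, (r <= u n)%E) -> (r <= limn_einf u)%E.
Proof.
move=> [N _ ru]; rewrite limn_einf_lim; apply: lime_ge.
  exact: is_cvg_einfs.
exists N => // n /= Nn; apply/ereal_infP => _ [k /= nk <-].
by apply: ru; rewrite /= (leq_trans Nn).
Qed.

End Limits.

(** * Disjoint non-singularity and lower bounds on small supports *)

Section Characterization.
Context {R : realType} {d : measure_display} {Om : measurableType d}.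
Context {mu : probability Om R} {E Y : normedModType R} {j : E -> Om -> R}.
Variable T : {linear E -> Y}.
Hypothesis HE : kothe_repr mu j.

Lemma ae_supp_span (x : nat -> E) s : span_seq x s ->
  {ae mu, forall t, supp j s t -> (\bigcup_m supp j (x m)) t}.
Proof.
move=> [n [a ->]]; apply: filterS (ae_repr_sum HE (fun _ : 'I_n => true) a x) => t.
rewrite /supp /= => ->; apply: contraPP => nx; rewrite big1 ?eqxx// => i _.
have [->|xi] := eqVneq (j (x i) t) 0; first by rewrite mulr0.
by case: nx; exists i.
Qed.

Lemma closed_span_infinite_dim (x : nat -> E) : (forall n, x n != 0) ->
  (forall n m, n != m -> ldisjoint mu j (x n) (x m)) ->
  infinite_dim (closed_span x).
Proof.
move=> x0 dx n; exists (fun i => x i); split=> [i|a ax i].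
  apply: subset_closure; exists i.+1, (fun k => (k == i :> nat)%:R).
  rewrite big_ord_recr /= eqxx scale1r big1 ?add0r// => k _.
  by rewrite ltn_eqF// scale0r.
(* Extension of the finite family [a] by 0 to all indices. *)
pose b k := oapp a 0 (insub k : option 'I_n).
have bE (k : 'I_n) : b k = a k by rewrite /b valK.
have := unconditional_coef b (disjoint_unconditional HE dx) (ltn_ord i).
under eq_bigr do rewrite bE.
rewrite ax normr0 bE pmulr_lle0 ?normr_gt0// normr_le0.
by move/eqP.
Qed.

(** The same [r] is an isomorphism constant on the closed span of a tail, whose elements all live on
    one set of measure below [r]. *)
Lemma DNS_of_lower_bound (r : R) : 0 < r ->
  (forall x, `|x| = 1 -> (mu (supp j x) < r%:E)%E -> r < `|T x|) ->
  DNS mu j T.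
Proof.
move=> r0 rT [x [x0 [dx ss]]].
have [N _ /(_ N (leqnn N)) /= BN] := cvg0_lt_near (disjoint_tails_cvg HE dx) r0.
pose xN m := x (N + m)%N.
set B := \bigcup_m _ in BN.
have mB : measurable B by apply: bigcup_measurable => m _; exact: measurable_supp HE _.
have dxN n m : n != m -> ldisjoint mu j (xN n) (xN m).
  by move=> nm; apply: dx; rewrite eqn_add2l.
apply: (ss (closed_span xN)).
- apply: closure_subset => _ [n [a ->]].
  (* A combination of the tail is one of [x] whose first [N] coefficients are 0. *)
  exists (N + n)%N, (fun k => if (N <= k)%N then a (k - N)%N else 0).
  rewrite big_split_ord /= [X in _ = X + _]big1 ?add0r => [|i _].
    by apply: eq_bigr => i _; rewrite leq_addr addKn.
  by rewrite leqNgt ltn_ord scale0r.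
- exact/closure_lsubspace/span_seq_lsubspace.
- exact: closed_closure.
- by apply: closed_span_infinite_dim => // n; exact: x0.
exists r; split => // z zN.
have [->|z0] := eqVneq z 0; first by rewrite normr0 mulr0.
have nz0 : 0 < `|z| by rewrite normr_gt0.
have zB : {ae mu, forall t, supp j z t -> B t}.
  by apply: (ae_supp_closure HE mB) zN => s; exact: ae_supp_span.
have := rT (`|z|^-1 *: z).
rewrite normrZ gtr0_norm ?invr_gt0// mulVf ?gt_eqF// => /(_ erefl).
rewrite linearZ normrZ gtr0_norm ?invr_gt0// mulrC ltr_pdivlMr//.
move=> H; apply/ltW/H; apply: le_lt_trans BN.
apply: ae_le_measure => //; first exact: measurable_supp HE _.
apply: filterS2 zB (ae_reprZ HE `|z|^-1 z) => t zB zE.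
rewrite /supp /= zE mulf_eq0 negb_or => /andP[_]; exact: zB.
Qed.

(** * Disjoint sequences with small images, when (4) fails *)

Section Construction.
Hypothesis Tb : bounded_op T.
Hypothesis Tsmall : forall r : R, 0 < r ->
  exists x, [/\ `|x| = 1, (mu (supp j x) < r%:E)%E & `|T x| <= r].

(** A bounded [y] near [x] is cut off to the support of [x]: this keeps the support small and does
    not increase the distance to [x]. *)
Lemma bounded_small_image (r : R) : 0 < r ->
  exists x, [/\ exists M, ess_bdd_by mu (j x) M, (mu (supp j x) < r%:E)%E,
    3 / 4 < `|x| & `|T x| < r].
Proof.
move=> r0; have r20 : 0 < r / 2 by lra.
have [x [x1 xr Tx]] := Tsmall r20.
have [M M0 TM] := bounded_op_ge0 Tb.
have M1 : 0 < M + 1 by lra.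
(* The bound [4^-1] keeps the norm above [3 / 4]; the other gives [M * e < r / 2], strictly because
   of the [+ 1]. *)
pose e := Num.min (4^-1) (r / 2 / (M + 1)).
have e0 : 0 < e by rewrite lt_min divr_gt0// andbT; lra.
have e4 : e <= 4^-1 by rewrite ge_min lexx.
have eM : e * (M + 1) <= r / 2.
  by rewrite -ler_pdivlMr// ge_min lexx orbT.
have [y [K [yK xy]]] := kr_denseInf HE x e0.
have mx := measurable_supp HE x.
have [u uE] := repr_restrict HE mx yK.
have xu : `|x - u| < e.
  apply: le_lt_trans xy; apply: (kr_riesz HE).
  apply: filterS3 uE (ae_reprB HE x u) (ae_reprB HE x y) => t uE -> ->.
  rewrite uE indicE; case: (boolP (t \in _)); rewrite ?mul1r// notin_setE.
  by rewrite /supp /= => /negP/negPn/eqP ->; rewrite mul0r subr0 normr0.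
exists u; split.
- exists K; apply: filterS2 yK uE => t yK ->; rewrite indicE.
  case: (_ \in _); rewrite ?mul1r// mul0r normr0.
  exact: le_trans yK.
- apply: (@le_lt_trans _ _ (mu (supp j x))).
    apply: ae_le_measure => //; first exact: measurable_supp HE _.
    apply: filterS uE => t; rewrite /supp /= => ->.
    rewrite mulf_eq0 negb_or indicE => /andP[+ _].
    by case: (boolP (t \in _)); rewrite ?eqxx// inE.
  apply: lt_trans xr _; rewrite lte_fin; lra.
- have : `|x| <= `|x - u| + `|u| by rewrite -{1}[x](subrK u) ler_normD.
  by rewrite x1; lra.
- have -> : T u = T x - T (x - u) by rewrite linearB opprB addrC subrK.
  have h : M * `|x - u| <= M * e by rewrite ler_wpM2l// ltW.
  have := TM (x - u).
  have := ler_normB (T x) (T (x - u)); lra.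
Qed.

(* Sliding hump: the supports of the later terms are chosen so small that cutting
   [x k] off on their union changes it by less than [r k]. *)
Lemma disjoint_small_images : exists (y : nat -> E) (C : R),
  [/\ forall n m, n != m -> ldisjoint mu j (y n) (y m),
      forall i, 2^-1 <= `|y i| & forall i, `|T (y i)| <= C * 2^-1 ^+ i].
Proof.
have [M M0 TM] := bounded_op_ge0 Tb.
(* [X] and [D] are chosen for every real, with the dummy value 0 off the positive ones, so that the
   radii can be defined by recursion. *)
have /choice[X hX] : forall r : R, exists x, 0 < r ->
    [/\ exists M, ess_bdd_by mu (j x) M, (mu (supp j x) < r%:E)%E,
    3 / 4 < `|x| & `|T x| < r].
  move=> r; have [r0|_] := ltP 0 r; last by exists 0.
  by have [x hx] := bounded_small_image r0; exists x.
have /choice[D hD] : forall r : R, exists dl : R, 0 < r -> 0 < dl /\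
    forall (A : set Om) u, measurable A -> (mu A < dl%:E)%E ->
    {ae mu, forall t, j u t = \1_A t * j (X r) t} -> `|u| < r.
  move=> r; have [r0|_] := ltP 0 r; last by exists 0.
  have [[K XK] _ _ _] := hX r r0.
  have [dl dl0 H] := bounded_absolutely_continuous HE XK r0.
  by exists dl.
(* Halving gives geometric decay. The bound by [D (r i) / 4] makes the union of all later supports,
   of measure at most [2 * r i.+1], smaller than [D (r i)]. The start [4^-1] leaves norm
   [3 / 4 - 1 / 4]. *)
pose r := fix r k := if k is i.+1 then Num.min (r i / 2) (D (r i) / 4) else 4^-1 : R.
have r_gt0 k : 0 < r k.
  elim: k => [|k IH] /=; first by lra.
  by rewrite lt_min !divr_gt0//; case: (hD _ IH).
have r_half k : r k.+1 <= r k / 2 by rewrite /= ge_min lexx.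
have r_D k : r k.+1 <= D (r k) / 4 by rewrite /= ge_min lexx orbT.
have r_geo k m : r (k + m)%N <= r k * 2^-1 ^+ m.
  elim: m => [|m IH]; first by rewrite addn0 mulr1.
  rewrite addnS; apply: le_trans (r_half _) _.
  by rewrite exprSr mulrA ler_wpM2r// invr_ge0.
pose x k := X (r k).
have xP k := hX _ (r_gt0 k).
pose A k := \bigcup_m supp j (x (k.+1 + m)%N).
have mA k : measurable (A k).
  by apply: bigcup_measurable => m _; exact: measurable_supp HE _.
have muA k : (mu (A k) < (D (r k))%:E)%E.
  have [D0 _] := hD _ (r_gt0 k).
  apply: (@le_lt_trans _ _ (2 * r k.+1)%:E).
    apply: measure_bigcup_geometric => [|m|m].
    - by rewrite mulr_ge0// ltW.
    - exact: measurable_supp HE _.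
    - have [_ /ltW h _ _] := xP (k.+1 + m)%N; apply: le_trans h _.
      rewrite lee_fin; apply: le_trans (r_geo _ _) _.
      by rewrite natrX -exprVn exprS; lra.
  by rewrite lte_fin; have := r_D k; lra.
have /choice[y yE] k : exists u, {ae mu, forall t, j u t = \1_(~` A k) t * j (x k) t}.
  have [[K XK] _ _ _] := xP k.
  by apply: (repr_restrict HE _ XK); exact: measurableC.
have xy k : `|x k - y k| < r k.
  have [_] := hD _ (r_gt0 k); apply; [exact: mA|exact: muA|].
  apply: filterS2 (ae_reprB HE (x k) (y k)) (yE k) => t -> ->.
  rewrite !indicE in_setC; case: (t \in _); rewrite ?mul0r ?mul1r ?subr0//.
  by rewrite subrr.
have r_geo0 k : r k <= 4^-1 * 2^-1 ^+ k by exact: r_geo 0%N k.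
exists y, (1 + M); split.
(* Where [x m] is nonzero with [n < m], the point lies in [A n], and [y n] was cut off there. *)
- have dlt n m : (n < m)%N -> ldisjoint mu j (y n) (y m).
    move=> nm; apply: filterS2 (yE n) (yE m) => t -> ->.
    have [xm|xm] := eqVneq (j (x m) t) 0.
      by rewrite xm mulr0 normr0; apply/min_idPr.
    rewrite [X in Num.min X _](_ : _ = 0); first exact/min_idPl.
    rewrite indicE memNset ?mul0r ?normr0//= => nA; apply: nA.
    by exists (m - n.+1)%N => //; rewrite subnKC.
  move=> n m; rewrite neq_ltn => /orP[|/dlt h]; first exact: dlt.
  by apply: filterS h => t; rewrite minC.
- move=> k; have [_ _ xk _] := xP k.
  have : r k <= 4^-1.
    apply: le_trans (r_geo0 k) _; rewrite ler_piMr// exprn_ile1//; lra.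
  have := xy k; have : `|x k| <= `|x k - y k| + `|y k|.
    by rewrite -{1}[x k](subrK (y k)) ler_normD.
  rewrite /x; lra.
- move=> k; have [_ _ _ Tx] := xP k.
  have -> : T (y k) = T (x k) - T (x k - y k).
    by rewrite linearB opprB addrC subrK.
  have h : M * `|x k - y k| <= M * r k by rewrite ler_wpM2l// ltW.
  have h2 : (1 + M) * r k <= (1 + M) * 2^-1 ^+ k.
    rewrite ler_wpM2l//; first by lra.
    apply: le_trans (r_geo0 k) _; rewrite ler_piMl// ?exprn_ge0//; lra.
  have := TM (x k - y k); have := ler_normB (T (x k)) (T (x k - y k)).
  rewrite /x in h Tx *; lra.
Qed.

Lemma small_images_not_DNS : ~ DNS mu j T.
Proof.
have [y [C [dy y_ge TC]]] := disjoint_small_images.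
have ss := summable_images_strictly_singular (disjoint_unconditional HE dy) y_ge Tb TC.
by apply; exists y; split=> // n; rewrite -normr_gt0; have := y_ge n; lra.
Qed.

End Construction.

End Characterization.

Unset Implicit Arguments.

Theorem theorem3p1 (R : realType) (d : measure_display) (Om : measurableType d)
  (mu : probability Om R) (E : completeNormedModType R) (j : E -> Om -> R)
  (HE : kothe_repr mu j)
  (Y : completeNormedModType R) (T : {linear E -> Y}) (Tb : bounded_op T) :
  [<-> DNS mu j T;
       exists r : R, 0 < r /\ forall x : nat -> E, (forall n, `|x n| = 1) ->
         (mu (supp j (x n)) @[n --> \oo] --> 0%E) ->
         (r%:E < limn_einf (fun n => (`|T (x n)|)%:E))%E;
       forall x : nat -> E, (forall n, `|x n| = 1) ->
         (mu (supp j (x n)) @[n --> \oo] --> 0%E) ->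
         (0%E < limn_einf (fun n => (`|T (x n)|)%:E))%E;
       exists r : R, 0 < r /\ forall x : E, `|x| = 1 ->
         (mu (supp j x) < r%:E)%E -> r < `|T x|].
Proof.
tfae.
- move=> dns.
  (* Condition (4) is obtained first, by contraposition, and (2) is read off from it. *)
  have [r [r0 rT]] : exists r : R, 0 < r /\ forall x : E, `|x| = 1 ->
      (mu (supp j x) < r%:E)%E -> r < `|T x|.
    apply: contrapT => H; apply: (small_images_not_DNS HE Tb _ dns) => r r0.
    apply: contrapT => H'; apply: H; exists r; split => // x x1 xr.
    by rewrite ltNge; apply/negP => Tx; apply: H'; exists x.
  (* The lower limit is only known to be at least [r]; halving makes the inequality strict. *)
  exists (r / 2); split=> [|x x1 x0]; first by lra.
  apply: (@lt_le_trans _ _ r%:E); first by rewrite lte_fin; lra.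
  apply: limn_einf_ge; apply: filterS (cvg0_lt_near x0 r0) => n xr.
  by rewrite lee_fin ltW// rT.
- move=> [r [r0 H]] x x1 x0; apply: lt_trans (H x x1 x0).
  by rewrite lte_fin.
(* Failure of (4) at each radius [1 / (n + 1)] gives unit vectors whose supports and images both
   tend to 0, against (3). *)
- move=> H; apply: contrapT => H4.
  have /choice[x xP] n : exists x, [/\ `|x| = 1,
      (mu (supp j x) < (n.+1%:R^-1)%:E)%E & `|T x| <= n.+1%:R^-1].
    apply: contrapT => nx; apply: H4; exists (n.+1%:R^-1).
    split; first by rewrite invr_gt0.
    move=> x x1 xr; rewrite ltNge; apply/negP => Tx.
    by apply: nx; exists x.
  have cvg0 (u : nat -> \bar R) : (forall n, 0%E <= u n <= (n.+1%:R^-1)%:E)%E ->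
      u @ \oo --> 0%E.
    move=> u0; apply: (@squeeze_cvge _ _ _ _ (cst 0%E) _
      (fun n => (n.+1%:R^-1)%:E)); first exact: nearW.
      exact: cvg_cst.
    by apply: cvg_EFin; [exact: nearW|exact: cvg_harmonic].
  have Tx0 : (`|T (x n)|)%:E @[n --> \oo] --> (0 : \bar R)%E.
    by apply: cvg0 => n; have [_ _ Tx] := xP n; rewrite !lee_fin normr_ge0.
  have x0 : mu (supp j (x n)) @[n --> \oo] --> 0%E.
    by apply: cvg0 => n; have [_ /ltW -> _] := xP n; rewrite measure_ge0.
  have x1 n : `|x n| = 1 by case: (xP n).
  by have := H x x1 x0; rewrite (cvg_limn_einf_sup Tx0) ltxx.
- by move=> [r [r0 rT]]; exact: (DNS_of_lower_bound HE r0 rT).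
Qed.
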